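(* Let $r\ge2$ and let $n\ge k$ be positive integers, and endow monomials in $\mathbb{C}[x_1,\dots,x_n]$ with the lexicographic term order $<$. Then: (1) the collection $\mathcal{M}_{n,k}$ of $(n,k)$-nonskip monomials is the standard monomial basis of $R_{n,k}$; (2) the collection $\mathcal{N}_{n,k}$ of strongly $(n,k)$-nonskip monomials is the standard monomial basis of $S_{n,k}$.
   Context: With $e_d(\mathbf{x}_n^r)=e_d(x_1^r,\dots,x_n^r)$ the elementary symmetric polynomials in $x_1^r,\dots,x_n^r$, set $$I_{n,k}=\langle x_1^{kr+1},\dots,x_n^{kr+1},e_n(\mathbf{x}_n^r),\dots,e_{n-k+1}(\mathbf{x}_n^r)\rangle,\quad J_{n,k}=\langle x_1^{kr},\dots,x_n^{kr},e_n(\mathbf{x}_n^r),\dots,e_{n-k+1}(\mathbf{x}_n^r)\rangle,$$ $R_{n,k}=\mathbb{C}[x_1,\dots,x_n]/I_{n,k}$ and $S_{n,k}=\mathbb{C}[x_1,\dots,x_n]/J_{n,k}$. The lexicographic order: $x_1^{a_1}\cdots x_n^{a_n}<x_1^{b_1}\cdots x_n^{b_n}$ if there is $i$ with $a_1=b_1,\dots,a_{i-1}=b_{i-1}$ and $a_i<b_i$. The standard monomial basis of $\mathbb{C}[x_1,\dots,x_n]/I$ is the set of monomials not divisible by the leading monomial of any nonzero element of $I$. For $S=\{s_1<\cdots<s_m\}\subseteq[n]=\{1,\dots,n\}$ the skip monomial is $\mathbf{x}(S)=x_{s_1}^{s_1}x_{s_2}^{s_2-1}\cdots x_{s_m}^{s_m-m+1}$.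 A monomial $m$ is $(n,k)$-nonskip if $x_i^{kr+1}\nmid m$ for all $1\le i\le n$ and $\mathbf{x}(S)^r\nmid m$ for all $S\subseteq[n]$ with $|S|=n-k+1$; it is strongly $(n,k)$-nonskip if moreover $x_i^{kr}\nmid m$ for all $1\le i\le n$. *)

(* Defs.v *)
From mathcomp Require Import all_boot all_order all_algebra.
From mathcomp Require Import mpoly.

Set Implicit Arguments.
Unset Strict Implicit.
Unset Printing Implicit Defensive.

Import GRing.Theory.
Local Open Scope ring_scope.

Section Definitions.
Variables (F : comNzRingType) (n : nat).
Implicit Types (p f : {mpoly F[n]}) (m : 'X_{1..n}) (gs : seq {mpoly F[n]}).

Definition ideal_gen gs p : Prop :=
  exists c : 'I_(size gs) -> {mpoly F[n]},
    p = \sum_(i < size gs) c i * gs`_i.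

(* The order [<]%O that the library puts on ['X_{1..n}] (hence [mlead]) is
   degrevlex, so the lexicographic one with x_1 > ... > x_n is set up here. *)
Definition lex_lt m1 m2 : bool :=
  [exists i : 'I_n,
     [forall (j : 'I_n | (j < i)%N), m1 j == m2 j] && (m1 i < m2 i)%N].

Definition lex_lead p m : Prop :=
  m \in msupp p /\ {in msupp p, forall m', m' != m -> lex_lt m' m}.

Definition standard_monomial (I : {mpoly F[n]} -> Prop) m : Prop :=
  forall f l, I f -> f != 0 -> lex_lead f l -> ~~ (l <= m)%MM.

Definition is_standard_monomial_basis
    (I : {mpoly F[n]} -> Prop) (B : pred 'X_{1..n}) : Prop :=
  forall m, B m <-> standard_monomial I m.

Variables (k r : nat).

Definition esym_pow (d : nat) : {mpoly F[n]} :=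
  mesym n F d \mPo [tuple 'X_i ^+ r | i < n].

(* e_n(x^r), e_(n-1)(x^r), ..., e_(n-k+1)(x^r), meant for k <= n. *)
Definition esym_gens : seq {mpoly F[n]} :=
  [seq esym_pow (n - j) | j <- iota 0 k].

Definition idealI : {mpoly F[n]} -> Prop :=
  ideal_gen ([seq 'X_i ^+ (k * r).+1 | i <- enum 'I_n] ++ esym_gens).

Definition idealJ : {mpoly F[n]} -> Prop :=
  ideal_gen ([seq 'X_i ^+ (k * r) | i <- enum 'I_n] ++ esym_gens).

End Definitions.

(* Variable i : 'I_n is x_(i+1); if i = s_j - 1 is the j-th smallest element
   of S, then #|{l in S | l < i}| = j - 1, so the exponent is s_j - j + 1. *)
Definition skip_mon n (S : {set 'I_n}) : 'X_{1..n} :=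
  [multinom (if i \in S then i.+1 - #|[set l in S | (l < i)%N]| else 0)%N
     | i < n].

Definition nonskip n k r (m : 'X_{1..n}) : bool :=
  [forall i : 'I_n, ~~ (U_(i) *+ (k * r).+1 <= m)%MM]
  && [forall (S : {set 'I_n} | #|S| == (n - k).+1),
        ~~ (skip_mon S *+ r <= m)%MM].

Definition strongly_nonskip n k r (m : 'X_{1..n}) : bool :=
  nonskip k r m && [forall i : 'I_n, ~~ (U_(i) *+ (k * r) <= m)%MM].

(* Main.v *)
Require Import Defs.
From mathcomp Require Import all_boot all_order all_algebra.
From mathcomp Require Import zify ring perm separable cyclotomic.
From mathcomp Require Import reals complex mpoly.

Set Implicit Arguments.
Unset Strict Implicit.
Unset Printing Implicit Defensive.

Import GRing.Theory Num.Theory.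
Local Open Scope ring_scope.

(** Both parts are the case [eps = 1] or [eps = 0] of one statement, about the
    ideal [I] generated by the [x_i ^ D] with [D = k * r + eps] and by the top
    [k] elementary symmetric polynomials in the [x_i ^ r], and about the
    monomials with all exponents below [D] that no [r]-th power of a skip
    monomial with [n - k + 1] variables divides.  Two things are needed.

    Every other monomial is the leading monomial of an element of [I]
    ([lead_of_bounded_nonskip]).  This reduces to finding, for [r = 1], an
    element of the ideal <e_n, ..., e_(n-k+1)> with leading monomial [x(S)]
    ([skip_mon_lead]).  For the set [S] of the last [n - k + 1] indices, [x(S)]
    itself is in the ideal ([prod_last_vars_ideal]).  The other sets are reached
    by moving elements of [S] down one step at a time; each step is a divided
    difference in two adjacent variables, under which an ideal with symmetric
    generators is stable and which acts on leading monomials as required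
    ([divided_difference_lead]).

    No bounded nonskip monomial leads an element of [I]
    ([lead_not_bounded_nonskip]).  This is a dimension count by orbit harmonics.
    Let [Y] be the set of points whose coordinates satisfy
    [x ^ r = 1 ^ r, 2 ^ r, ..., k ^ r], or [x = 0] if [eps = 1], and for which
    each of these [k] nodes occurs at some coordinate.  Every homogeneous
    element of [I] is the top-degree part of a polynomial that vanishes on [Y]:
    for [x_i ^ D] take the product of the [x_i - z] over the [D] possible
    coordinates [z] ([top_vanishing_pow]); for [e_(n-j)] use that the product of
    the [T - x_i ^ r] is on [Y] a multiple of the product of the [T - j ^ r], so
    its remainder vanishes ([top_vanishing_esym]).  Hence every monomial outside
    the nonskip ones reduces on [Y] to monomials smaller for the
    degree-then-lexicographic order, and the nonskip monomials span the
    functions on [Y].  There are at most as many nonskip monomials as points: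
    reading the exponents greedily and reading the coordinates of a point give
    the same recursion ([count_unskipped] and [count_covers]).  So the nonskip
    monomials are linearly independent on [Y], which an element of [I] led by
    one of them would contradict ([footprint]). *)

(** * Lexicographic order and leading monomials *)

Section LexOrder.
Variable n : nat.
Implicit Types m a b c : 'X_{1..n}.

Lemma lex_ltP m1 m2 :
  reflect (exists2 i : 'I_n, forall j : 'I_n, (j < i)%N -> m1 j = m2 j
             & (m1 i < m2 i)%N)
          (lex_lt m1 m2).
Proof.
apply: (iffP existsP) => [[i /andP[/forall_inP eq_lt lt_i]]|[i eq_lt lt_i]].
  by exists i => // j /eq_lt /eqP.
by exists i; rewrite lt_i andbT; apply/forall_inP => j /eq_lt ->.
Qed.

Lemma lex_lt_irr m : lex_lt m m = false.
Proof. by apply/lex_ltP => -[i _]; rewrite ltnn. Qed.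

Lemma lex_lt_trans b a c : lex_lt a b -> lex_lt b c -> lex_lt a c.
Proof.
move=> /lex_ltP[i eq_i lt_i] /lex_ltP[j eq_j lt_j]; apply/lex_ltP.
case: (ltngtP i j) => [lt_ij|lt_ji|/val_inj eq_ij].
- exists i => [l lt_li|]; last by rewrite -eq_j.
  by rewrite eq_i // eq_j // (ltn_trans lt_li).
- exists j => [l lt_lj|]; last by rewrite eq_i.
  by rewrite eq_i ?eq_j // (ltn_trans lt_lj).
- subst j; exists i => [l lt_li|]; first by rewrite eq_i ?eq_j.
  exact: ltn_trans lt_j.
Qed.

Lemma lex_lt_total a b : [|| a == b, lex_lt a b | lex_lt b a].
Proof.
case: eqVneq => //= neq_ab.
have [i neq_i]: exists i : 'I_n, a i != b i.
  apply/existsP; apply: contraNT neq_ab => /existsPn eq_ab.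
  by apply/eqP/mnmP => i; apply/eqP; move: (eq_ab i); rewrite negbK.
case: (arg_minnP (P := fun i => a i != b i) (fun i : 'I_n => i : nat) neq_i) => j neq_j min_j.
have eq_lt (l : 'I_n) : (l < j)%N -> a l = b l.
  by move=> lt_lj; apply/eqP; apply: contraTT lt_lj => /min_j; rewrite -leqNgt.
case: (ltngtP (a j) (b j)) neq_j => // lt_j _; apply/orP.
  by left; apply/lex_ltP; exists j.
by right; apply/lex_ltP; exists j => // l /eq_lt.
Qed.

Lemma lex_lt_add2l a b c : lex_lt (a + b)%MM (a + c)%MM = lex_lt b c.
Proof.
apply/lex_ltP/lex_ltP => -[i eq_i lt_i]; exists i => [j /eq_i|].
- by rewrite !mnmDE => /addnI.
- by move: lt_i; rewrite !mnmDE ltn_add2l.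
- by rewrite !mnmDE => ->.
- by rewrite !mnmDE ltn_add2l.
Qed.

Lemma lex_lt_mul2r r a b : (0 < r)%N -> lex_lt (a *+ r)%MM (b *+ r)%MM = lex_lt a b.
Proof.
move=> r_gt0.
apply/lex_ltP/lex_ltP => -[i eq_i lt_i]; exists i => [j /eq_i|].
- by rewrite !mulmnE => /eqP; rewrite eqn_pmul2r // => /eqP.
- by move: lt_i; rewrite !mulmnE ltn_pmul2r.
- by rewrite !mulmnE => ->.
- by rewrite !mulmnE ltn_pmul2r.
Qed.

Lemma lex_lt_mnm1 (i j : 'I_n) : (i < j)%N -> lex_lt U_(j)%MM U_(i)%MM.
Proof.
move=> lt_ij; apply/lex_ltP; exists i => [l lt_li|].
  rewrite !mnm1E -!val_eqE /= (gtn_eqF lt_li) gtn_eqF //.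
  exact: ltn_trans lt_ij.
by rewrite !mnm1E eqxx -val_eqE /= gtn_eqF.
Qed.

(** The polynomials vanishing on a finite set of points are not homogeneous, so
    reducing modulo them needs an order that compares degrees first. *)
Definition deglex_lt a b :=
  (mdeg a < mdeg b)%N || (mdeg a == mdeg b) && lex_lt a b.

Lemma deglex_lt_irr a : deglex_lt a a = false.
Proof. by rewrite /deglex_lt ltnn lex_lt_irr andbF. Qed.

Lemma deglex_lt_trans b a c : deglex_lt a b -> deglex_lt b c -> deglex_lt a c.
Proof.
rewrite /deglex_lt => /orP[lt_ab|/andP[/eqP-> lt_ab]] /orP[lt_bc|/andP[/eqP eq_bc lt_bc]].
- by rewrite (ltn_trans lt_ab).
- by rewrite -eq_bc lt_ab.
- by rewrite lt_bc.
- by rewrite eq_bc eqxx (lex_lt_trans lt_ab) ?orbT.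
Qed.

(** Only finitely many monomials have degree below a given bound, which gives
    termination of reductions for the degree-compatible order. *)
Lemma deglex_ind (P : 'X_{1..n} -> Prop) :
  (forall a, (forall b, deglex_lt b a -> P b) -> P a) -> forall a, P a.
Proof.
move=> IH a.
suff lt_rk B N b : (mdeg b < B)%N ->
    (#|[pred d : 'X_{1..n < B} | deglex_lt d b]| < N)%N -> P b.
  exact: (lt_rk _ _ a (ltnSn _) (ltnSn _)).
elim: N b => // N IHN b lt_bB lt_rkN; apply: IH => c lt_cb.
have lt_cB: (mdeg c < B)%N.
  by apply: leq_ltn_trans lt_bB; case/orP: lt_cb => [/ltnW|/andP[/eqP->]].
apply: IHN => //; rewrite -ltnS; apply: leq_trans lt_rkN; rewrite ltnS.
apply: proper_card; apply/properP; split.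
  by apply/subsetP => d; rewrite !inE => /deglex_lt_trans; apply.
by exists (BMultinom lt_cB); rewrite !inE /= ?deglex_lt_irr.
Qed.

End LexOrder.

Section LexLead.
Variables (R : idomainType) (n : nat).
Implicit Types (p q : {mpoly R[n]}) (m a b : 'X_{1..n}).

Definition deglex_lead p m : Prop :=
  m \in msupp p /\ {in msupp p, forall m', m' != m -> deglex_lt m' m}.

Lemma lex_lead_exists p : p != 0 -> exists m, lex_lead p m.
Proof.
rewrite -msupp_eq0 /lex_lead; elim: (msupp p) => // a s IHs _.
case: (eqVneq s [::]) => [->|/IHs[m [m_s max_m]]].
  by exists a; split=> [|b]; rewrite !inE // => /eqP->; rewrite eqxx.
have [eq_am|] := eqVneq a m.
  exists m; rewrite eq_am; split=> [|b]; first by rewrite inE eqxx.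
  by rewrite inE => /orP[/eqP->|/max_m //]; rewrite eqxx.
move=> neq_am; have := lex_lt_total a m; rewrite (negPf neq_am) /=.
case/orP => lt_am.
  exists m; split=> [|b]; first by rewrite inE m_s orbT.
  by rewrite inE => /orP[/eqP->|/max_m].
exists a; split=> [|b]; first by rewrite inE eqxx.
rewrite inE => /orP[/eqP->|b_s _]; first by rewrite eqxx.
have [->//|/(max_m _ b_s) lt_bm] := eqVneq b m.
exact: lex_lt_trans lt_am.
Qed.

Lemma lex_lead_uniq p a b : lex_lead p a -> lex_lead p b -> a = b.
Proof.
move=> [a_p max_a] [b_p max_b]; apply/eqP/negPn/negP => neq_ab.
have lt_ab := max_b _ a_p neq_ab; rewrite eq_sym in neq_ab.
by have := lex_lt_trans lt_ab (max_a _ b_p neq_ab); rewrite lex_lt_irr.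
Qed.

Lemma lex_lead_mulX p m a : lex_lead p m -> lex_lead (p * 'X_[a]) (a + m)%MM.
Proof.
move=> [m_p max_m]; split; first by rewrite (perm_mem (msuppMX _ _)) map_f.
move=> b; rewrite (perm_mem (msuppMX _ _)) => /mapP[c c_p ->].
by rewrite eqm_add2l lex_lt_add2l => /max_m; apply.
Qed.

(** Multiplying by a difference of variables shifts the leading monomial by
    the larger variable, the one of smaller index. *)
Lemma lex_lead_mulXB p m (i j : 'I_n) : (i < j)%N -> lex_lead p m ->
  lex_lead (('X_i - 'X_j) * p) (U_(i) + m)%MM.
Proof.
move=> lt_ij [m_p max_m].
have lt_jm b : b \in msupp p -> lex_lt (U_(j) + b)%MM (U_(i) + m)%MM.
  move=> b_p; have lt_m: lex_lt (U_(j) + m)%MM (U_(i) + m)%MM.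
    by rewrite ![(_ + m)%MM]addmC lex_lt_add2l lex_lt_mnm1.
  have [->//|/(max_m _ b_p) lt_bm] := eqVneq b m.
  by apply: lex_lt_trans lt_m; rewrite lex_lt_add2l.
rewrite mulrBl ![_ * p]mulrC; split.
  rewrite mcoeff_msupp mcoeffB mcoeffMX.
  rewrite [X in _ - X]memN_msupp_eq0 ?subr0 -?mcoeff_msupp //.
  apply/negP; rewrite (perm_mem (msuppMX _ _)) => /mapP[b /lt_jm + eq_b].
  by rewrite -eq_b lex_lt_irr.
move=> b /msuppB_le; rewrite mem_cat.
case/orP; rewrite (perm_mem (msuppMX _ _)) => /mapP[c c_p ->].
  by rewrite eqm_add2l lex_lt_add2l => /max_m; apply.
by move=> _; apply: lt_jm.
Qed.

Lemma comp_mpoly_powE (r : nat) p :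
  p \mPo [tuple 'X_i ^+ r | i < n] =
  \sum_(m <- msupp p) p@_m *: 'X_[(m *+ r)%MM].
Proof.
rewrite comp_mpolyEX; apply: eq_bigr => m _; congr (_ *: _).
rewrite comp_mpolyX mpolyXE_id; apply: eq_bigr => i _.
by rewrite tnth_mktuple mulmnE mulnC exprM.
Qed.

Lemma lex_lead_comp_pow (r : nat) p m : (0 < r)%N -> lex_lead p m ->
  lex_lead (p \mPo [tuple 'X_i ^+ r | i < n]) (m *+ r)%MM.
Proof.
move=> r_gt0 [m_p max_m]; have compE := comp_mpoly_powE r p.
have mulr_inj : injective (fun a => a *+ r)%MM.
  move=> a b /mnmP eq_ab; apply/mnmP => i; have /eqP := eq_ab i.
  by rewrite !mulmnE eqn_pmul2r // => /eqP.
split.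
  rewrite mcoeff_msupp compE raddf_sum (bigD1_seq m) //= mcoeffZ mcoeffX eqxx.
  rewrite mulr1 big1 ?addr0 -?mcoeff_msupp // => m' neq_m'.
  by rewrite mcoeffZ mcoeffX (inj_eq mulr_inj) (negPf neq_m') mulr0.
move=> a; rewrite compE => /msupp_sum_le /flattenP[s /mapP[m' m'_p ->]].
move: m'_p; rewrite mem_filter => m'_p /msuppZ_le; rewrite msuppX inE => /eqP->.
by rewrite (inj_eq mulr_inj) lex_lt_mul2r // => /max_m; apply.
Qed.

End LexLead.

(** * Ideals given by generators *)

Section IdealGen.
Variables (R : comNzRingType) (n : nat).
Implicit Types (p q c : {mpoly R[n]}) (gs : seq {mpoly R[n]}).

Lemma ideal_gen_ind gs (P : {mpoly R[n]} -> Prop) :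
    P 0 -> (forall p q, P p -> P q -> P (p + q)) ->
    (forall c g, g \in gs -> P (c * g)) ->
  forall p, ideal_gen gs p -> P p.
Proof.
move=> P0 PD PM p [c ->]; elim/big_ind: _ => // i _.
exact/PM/mem_nth.
Qed.

Lemma ideal_gen0 gs : ideal_gen gs 0.
Proof. by exists (fun=> 0); rewrite big1 // => i _; rewrite mul0r. Qed.

Lemma ideal_genD gs p q : ideal_gen gs p -> ideal_gen gs q -> ideal_gen gs (p + q).
Proof.
move=> [c ->] [d ->]; exists (fun i => c i + d i); rewrite -big_split /=.
by apply: eq_bigr => i _; rewrite mulrDl.
Qed.

Lemma ideal_genM gs c p : ideal_gen gs p -> ideal_gen gs (c * p).
Proof.
move=> [d ->]; exists (fun i => c * d i); rewrite mulr_sumr.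
by apply: eq_bigr => i _; rewrite mulrA.
Qed.

Lemma ideal_genB gs p q : ideal_gen gs p -> ideal_gen gs q -> ideal_gen gs (p - q).
Proof.
by move=> Ip Iq; apply: ideal_genD => //; rewrite -mulN1r; apply: ideal_genM.
Qed.

Lemma ideal_gen_sum gs (I : Type) (s : seq I) (P : pred I) (f : I -> {mpoly R[n]}) :
  (forall i, P i -> ideal_gen gs (f i)) -> ideal_gen gs (\sum_(i <- s | P i) f i).
Proof. by move=> If; elim/big_ind: _ => //; [apply: ideal_gen0 | apply: ideal_genD]. Qed.

Lemma ideal_gen_mem gs g : g \in gs -> ideal_gen gs g.
Proof.
move=> g_gs; exists (fun i => (i == index g gs :> nat)%:R).
have lt_g: (index g gs < size gs)%N by rewrite index_mem.
rewrite (bigD1 (Ordinal lt_g)) //= eqxx mul1r nth_index // big1 ?addr0 // => i.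
by rewrite -val_eqE => /negPf ->; rewrite mul0r.
Qed.

End IdealGen.

(** * Elements of the ideal led by skip monomials *)

Section DividedDifference.
Variables (R : idomainType) (n : nat).
Implicit Types (p q c : {mpoly R[n]}) (gs : seq {mpoly R[n]}).

(** The property is stable under products, by the twisted Leibniz rule
    [s (p q) - p q = (s p - p) s q + p (s q - q)], so it suffices to look at the
    variables. *)
Lemma msym_subr_dvd (i j : 'I_n) p :
  exists q, msym (tperm i j) p - p = ('X_i - 'X_j) * q.
Proof.
pose dvdij q := exists q', msym (tperm i j) q - q = ('X_i - 'X_j) * q'.
have dvdM q q' : dvdij q -> dvdij q' -> dvdij (q * q').
  move=> [u Du] [u' Du']; exists (u * msym (tperm i j) q' + q * u').
  by rewrite mulrDr mulrA -Du mulrCA -Du' msymM; ring.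
have dvd1 : dvdij 1 by exists 0; rewrite msym1 subrr mulr0.
have dvdX m : dvdij 'X_[m].
  rewrite mpolyXE_id; elim/big_ind: _ => // l _.
  elim: (m l) => [|e IHe]; rewrite ?expr0 // exprS; apply: dvdM => {IHe}//.
  rewrite /dvdij /msym mmapX mmap1U; case: tpermP => [->|->|_ _].
  - by exists (-1); rewrite mulrN1 opprB.
  - by exists 1; rewrite mulr1.
  - by exists 0; rewrite subrr mulr0.
elim/mpolyind: p => [|c m p _ _ [u Du]]; first by exists 0; rewrite msym0 subrr mulr0.
have [v Dv] := dvdX m; exists (c *: v + u).
by rewrite mulrDr -scalerAr -Dv -Du msymD msymZ scalerBr; ring.
Qed.

(** Divided differences preserve an ideal with symmetric generators, because
    they are linear over symmetric polynomials. *)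
Lemma divided_difference gs (i j : 'I_n) f :
  {in gs, forall g, g \is symmetric} -> ideal_gen gs f ->
  exists2 q, ideal_gen gs q & msym (tperm i j) f - f = ('X_i - 'X_j) * q.
Proof.
move=> gs_sym; elim/ideal_gen_ind => [|p q [u Iu Du] [v Iv Dv]|c g g_gs].
- by exists 0; [exact: ideal_gen0 | rewrite mulr0 msym0 subrr].
- exists (u + v); first exact: ideal_genD.
  by rewrite mulrDr -Du -Dv msymD; ring.
- have [u Du] := msym_subr_dvd i j c; exists (u * g).
    exact/ideal_genM/ideal_gen_mem.
  by rewrite mulrA -Du msymM (issymP _ (gs_sym _ g_gs)) mulrBl.
Qed.

(** If the leading monomial of [f] avoids ['X_i], then exchanging ['X_i] with the
    next variable ['X_j] takes no other monomial of [f] above the image of the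
    leading one.  So that image leads [s f - f], and dividing by ['X_i - 'X_j]
    removes a factor ['X_i] from it. *)
Lemma divided_difference_lead f m (i j : 'I_n) q :
    j = i.+1 :> nat -> lex_lead f m -> m i = 0%N -> (0 < m j)%N ->
    msym (tperm i j) f - f = ('X_i - 'X_j) * q ->
  forall m', (U_(i) + m')%MM = [multinom m (tperm i j l) | l < n] -> lex_lead q m'.
Proof.
move=> ji [m_f max_m] mi0 mj_gt0 Dq m' Dm'.
set s := tperm i j in Dq Dm'; set ms := [multinom m (s l) | l < n] in Dm'.
have lt_ij: (i < j)%N by rewrite ji.
have msE l : ms l = m (s l) by rewrite mnmE.
have ms_i : ms i = m j by rewrite msE tpermL.
have s_lt (l : 'I_n) : (l < i)%N -> s l = l.
  move=> lt_li; rewrite tpermD // -val_eqE /= gtn_eqF //.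
  exact: ltn_trans lt_ij.
have lt_m_ms : lex_lt m ms.
  apply/lex_ltP; exists i => [l lt_li|]; last by rewrite ms_i mi0.
  by rewrite msE s_lt.
have f_lt a : a \in msupp f -> lex_lt a ms.
  move=> a_f; have [->//|/(max_m _ a_f) lt_am] := eqVneq a m.
  exact: lex_lt_trans lt_m_ms.
have sf_lt a : a \in msupp f -> a != m -> lex_lt [multinom a (s l) | l < n] ms.
  move=> a_f /(max_m _ a_f) /lex_ltP[l eq_l lt_l]; apply/lex_ltP.
  have [lt_li|le_il] := ltnP l i.
    exists l => [u lt_ul|]; last by rewrite mnmE msE s_lt.
    by rewrite mnmE msE s_lt ?eq_l // (ltn_trans lt_ul).
  have neq_li : l != i by apply: contraTneq lt_l => ->; rewrite mi0.
  have lt_il : (i < l)%N by rewrite ltn_neqAle eq_sym neq_li.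
  have [lt_jl|] := ltnP j l.
    exists l => [u lt_ul|]; last first.
      by rewrite mnmE msE /s tpermD // -val_eqE /= ltn_eqF.
    by rewrite mnmE msE eq_l // /s; case: tpermP.
  rewrite leq_eqVlt ji ltnS leqNgt lt_il orbF => /eqP eq_lj.
  have {eq_lj} eq_lj : l = j by apply: val_inj; rewrite /= ji eq_lj.
  exists i => [u lt_ui|]; last by rewrite mnmE ms_i tpermL -eq_lj.
  by rewrite mnmE msE s_lt // eq_l // eq_lj (ltn_trans lt_ui).
have ss (a : 'X_{1..n}) : [multinom [multinom a (s l) | l < n] (s l) | l < n] = a.
  by apply/mnmP => l; rewrite !mnmE tpermK.
have lead_diff : lex_lead (msym s f - f) ms.
  split.
    rewrite mcoeff_msupp mcoeffB mcoeff_sym ss [f@_ms]memN_msupp_eq0.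
      by rewrite subr0 -mcoeff_msupp.
    by apply/negP => /f_lt; rewrite lex_lt_irr.
  move=> a /msuppB_le; rewrite mem_cat => /orP[|/f_lt //].
  rewrite mcoeff_msupp mcoeff_sym -mcoeff_msupp => as_f neq_a.
  rewrite -[a]ss; apply: sf_lt => //.
  by apply: contraNneq neq_a => eq_am; rewrite -[a]ss eq_am.
have q_neq0 : q != 0.
  apply/negP => /eqP q0; move: lead_diff; rewrite Dq q0 mulr0 => -[].
  by rewrite msupp0.
have [b lead_b] := lex_lead_exists q_neq0.
have := lex_lead_mulXB lt_ij lead_b; rewrite -Dq => /(lex_lead_uniq lead_diff).
by rewrite -Dm' => /addmI ->.
Qed.

End DividedDifference.

Lemma card_ord_ltn n c : (c <= n)%N -> #|[set i : 'I_n | (i < c)%N]| = c.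
Proof.
move=> le_cn; rewrite -sum1dep_card -(big_ord_widen n (fun=> 1%N) le_cn).
by rewrite sum1_card card_ord.
Qed.

Section SkipElements.
Variables (R : idomainType) (n k : nat).
Hypotheses (k_gt0 : (0 < k)%N) (le_kn : (k <= n)%N).

Let gs := [seq mesym n R (n - j) | j <- iota 0 k].

Lemma mesym_generic d :
  (mesym n {mpoly R[n]} d).@[tnth [tuple 'X_i | i < n]] = mesym n R d.
Proof.
rewrite /mesym raddf_sum; apply: eq_bigr => h _ /=.
by rewrite rmorph_prod; apply: eq_bigr => i _; rewrite /= mevalXU tnth_mktuple.
Qed.

Lemma coef_prod_subX_ideal j : (j < k)%N ->
  ideal_gen gs (\prod_(i < n) ('X - ('X_i)%:P) : {poly {mpoly R[n]}})`_j.
Proof.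
move=> lt_jk; have lt_jn := leq_trans lt_jk le_kn.
have lt_d : (n - j < n.+1)%N by rewrite ltnS leq_subr.
have := mroots_coeff [tuple ('X_i : {mpoly R[n]}) | i < n] (Ordinal lt_d).
rewrite /= subKn ?(ltnW lt_jn) // mesym_generic big_map big_enum /= => ->.
by apply/ideal_genM/ideal_gen_mem/map_f; rewrite mem_iota.
Qed.

(** Modulo the ideal, the polynomial with the roots [x_1, ..., x_n] is
    divisible by ['X^k].  Split it as [a * b], where [a] has the first [k - 1]
    variables as roots and [b] the others; the coefficients of ['X^0], ['X^1],
    ... in [a * b] then give [a`_j * b`_0 ^+ j.+1 = 0] by induction on [j], and
    [a] is monic of degree [k - 1]. *)
Lemma prod_last_vars_ideal :
  ideal_gen gs ((\prod_(i < n | (k.-1 <= i)%N) 'X_i) ^+ k).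
Proof.
pose a : {poly {mpoly R[n]}} := \prod_(i < n | (i < k.-1)%N) ('X - ('X_i)%:P).
pose b : {poly {mpoly R[n]}} := \prod_(i < n | (k.-1 <= i)%N) ('X - ('X_i)%:P).
have abE : \prod_(i < n) ('X - ('X_i)%:P) = a * b.
  rewrite (bigID (fun i : 'I_n => (i < k.-1)%N)) /=.
  by under [X in _ * X]eq_bigl do rewrite -leqNgt.
have I_ab j : (j < k)%N -> ideal_gen gs (a`_j * b`_0 ^+ j.+1).
  elim/ltn_ind: j => j IHj lt_jk; have := coef_prod_subX_ideal lt_jk.
  rewrite abE coefM big_ord_recr /= subnn => /(ideal_genM (b`_0 ^+ j)).
  rewrite mulrDr mulr_sumr; set s := \sum_(_ < _) _ => I_s.
  suff {I_s} /(ideal_genB I_s) : ideal_gen gs s.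
    by rewrite addrC addKr mulrCA exprSr.
  apply: ideal_gen_sum => i _; have lt_ij := ltn_ord i.
  have -> : b`_0 ^+ j * (a`_i * b`_(j - i)) =
      (b`_0 ^+ (j - i.+1) * b`_(j - i)) * (a`_i * b`_0 ^+ i.+1).
    by rewrite -{1}(subnK lt_ij) exprD; ring.
  by apply/ideal_genM/IHj => //; apply: ltn_trans lt_jk.
have a_monic : a`_k.-1 = 1.
  have size_a : size a = k.
    rewrite /a -big_filter size_prod_XsubC size_filter -sum1_count sum1dep_card.
    by rewrite card_ord_ltn ?prednK // (leq_trans (leq_pred k)).
  have : a \is monic by apply: monic_prod_XsubC.
  by rewrite monicE lead_coefE size_a => /eqP.
have b0E : b`_0 = (-1) ^+ #|[pred i : 'I_n | (k.-1 <= i)%N]|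
                  * \prod_(i < n | (k.-1 <= i)%N) 'X_i.
  rewrite -horner_coef0 horner_prod -prodrN; apply: eq_bigr => i _.
  by rewrite !hornerE.
have lt_k1k : (k.-1 < k)%N by rewrite prednK.
have := I_ab _ lt_k1k; rewrite a_monic mul1r prednK // b0E exprMn.
move=> /(ideal_genM (((-1) ^+ #|[pred i : 'I_n | (k.-1 <= i)%N]|) ^+ k)).
by rewrite mulrA -expr2 [_ ^+ k ^+ 2]exprAC sqrr_sign expr1n mul1r.
Qed.

(** Such a subset is closed upwards, and so is the last one; closed subsets are
    nested, so those of equal size coincide. *)
Lemma skip_mon_last (S : {set 'I_n}) :
    #|S| = (n - k).+1 ->
    (forall i j : 'I_n, i \in S -> j = i.+1 :> nat -> j \in S) ->
  S = [set i : 'I_n | (k.-1 <= i)%N].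
Proof.
move=> card_S S_succ; set T := [set i | _].
have S_up (d : nat) (i j : 'I_n) : i \in S -> j = (i + d)%N :> nat -> j \in S.
  elim: d j => [|d IHd] j iS; first by rewrite addn0 => /val_inj ->.
  rewrite addnS => eq_j; have lt_id : (i + d < n)%N by rewrite -ltnS -eq_j ltnS ltnW.
  by apply: (S_succ (Ordinal lt_id)) => //; apply: IHd.
have card_T : #|T| = (n - k).+1.
  have -> : T = ~: [set i : 'I_n | (i < k.-1)%N] by apply/setP => i; rewrite !inE leqNgt.
  have := cardsC [set i : 'I_n | (i < k.-1)%N].
  rewrite card_ord_ltn ?card_ord; last by rewrite (leq_trans (leq_pred k)).
  by lia.
have sub_TS : T \subset S.
  apply/subsetP => t tT; apply/negPn/negP => tS.
  have : S \proper T.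
    apply/properP; split; last by exists t.
    apply/subsetP => s sS; have lt_ts : (t < s)%N.
      rewrite ltnNge; apply/negP => le_st; move/negP: tS; apply.
      by apply: (S_up (t - s)%N s) => //; rewrite subnKC.
    by move: tT; rewrite !inE => /leq_trans; apply; apply: ltnW.
  by move/proper_card; rewrite card_S card_T ltnn.
by apply/esym/eqP; rewrite eqEcard sub_TS card_S card_T leqnn.
Qed.

Lemma skip_mon_lastE :
  skip_mon [set i : 'I_n | (k.-1 <= i)%N] = [multinom (if (k.-1 <= i)%N then k else 0%N) | i < n].
Proof.
apply/mnmP => i; rewrite !mnmE inE; case: ifP => // le_ki.
have cardE : #|[set l in [set i0 : 'I_n | (k.-1 <= i0)%N] | (l < i)%N]| = (i - k.-1)%N.
  have -> : [set l in [set i0 : 'I_n | (k.-1 <= i0)%N] | (l < i)%N] =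
      [set l : 'I_n | (l < i)%N] :\: [set l : 'I_n | (l < k.-1)%N].
    by apply/setP => l; rewrite !inE -leqNgt.
  rewrite cardsD (setIidPr _) ?card_ord_ltn ?(ltnW (ltn_ord i)) //.
    by rewrite (leq_trans le_ki) ?(ltnW (ltn_ord i)).
  by apply/subsetP => l; rewrite !inE => /leq_trans; apply.
by rewrite cardE; lia.
Qed.

(** If [i] is in [S] and [j = i.+1] is not, moving [i] to [j] replaces the factor
    ['X_i ^ c] of the skip monomial by ['X_j ^ c.+1] and leaves the other factors
    unchanged; a divided difference undoes this.  The sum of the [n - i] over [S]
    decreases under such moves, which end at the last subset. *)
Lemma skip_mon_lead (S : {set 'I_n}) : #|S| = (n - k).+1 ->
  exists2 f, ideal_gen gs f & lex_lead f (skip_mon S).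
Proof.
have [N] := ubnP (\sum_(i in S) (n - i))%N; elim: N S => // N IHN S lt_SN card_S.
have gs_sym : {in gs, forall g, g \is symmetric}.
  by move=> g /mapP[j _ ->]; apply: mesym_sym.
case: (boolP [exists i in S, exists j : 'I_n, (j == i.+1 :> nat) && (j \notin S)]).
  case/exists_inP => i iS /existsP[j /andP[/eqP ji jS]].
  pose s := tperm i j; pose S' := s @^-1: S.
  have s_inv : involutive s by move=> l; rewrite /s tpermK.
  have in_S' l : (l \in S') = (s l \in S) by rewrite inE.
  have iS' : i \notin S' by rewrite in_S' tpermL.
  have jS' : j \in S' by rewrite in_S' tpermR.
  have neq_ij : i != j by apply: contraNneq jS => <-.
  have card_S' : #|S'| = (n - k).+1.
    rewrite -card_S -(card_imset _ (inv_inj s_inv)); apply: eq_card => l.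
    by rewrite -{1}(s_inv l) (mem_imset _ _ (inv_inj s_inv)) in_S' s_inv.
  have lt_S'N : (\sum_(l in S') (n - l) < N)%N.
    rewrite -ltnS; apply: leq_trans lt_SN; rewrite ltnS.
    rewrite (bigD1 j) // [ltnRHS](bigD1 i) //=.
    have -> : (\sum_(l in S' | l != j) (n - l) = \sum_(l in S | l != i) (n - l))%N.
      apply: eq_big => l; last by [].
      rewrite in_S' /s; case: tpermP => [->|->|/eqP neq_li /eqP neq_lj].
      - by rewrite (negPf jS) eqxx andbF.
      - by rewrite (negPf jS) eqxx andbF.
      - by rewrite neq_li neq_lj.
    by rewrite ltn_add2r ji ltn_sub2l // (ltn_ord i).
  have [f I_f lead_f] := IHN _ lt_S'N card_S'.
  have [q I_q Dq] := divided_difference i j gs_sym I_f.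
  exists q => //.
  have card_lt (l : 'I_n) : l != j ->
      #|[set u in S' | (u < l)%N]| = #|[set u in S | (u < l)%N]|.
    move=> neq_lj; have s_lt u : (s u < l)%N = (u < l)%N.
      move: neq_lj; rewrite -val_eqE /= /s.
      by case: tpermP => [->|->|_ _] neq_lj; move: neq_lj ji; lia.
    rewrite -(card_imset _ (inv_inj s_inv)); apply: eq_card => u.
    by rewrite -{1}(s_inv u) (mem_imset _ _ (inv_inj s_inv)) !inE s_inv s_lt.
  have card_j : #|[set u in S' | (u < j)%N]| = #|[set u in S | (u < i)%N]|.
    rewrite -card_lt // ; apply: eq_card => u; rewrite !inE ji ltnS leq_eqVlt.
    have [/val_inj ->|//] := eqVneq (u : nat) i.
    by rewrite /s tpermL (negPf jS).
  have le_card (l : 'I_n) : (#|[set u in S | (u < l)%N]| <= l)%N.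
    rewrite -[leqRHS](card_ord_ltn (ltnW (ltn_ord l))).
    by apply: subset_leq_card; apply/subsetP => u; rewrite !inE => /andP[].
  apply: (divided_difference_lead ji lead_f _ _ Dq).
  - by rewrite mnmE (negPf iS').
  - by rewrite mnmE jS' card_j; have := le_card i; rewrite ji; lia.
  apply/mnmP => l; rewrite mnmDE mnm1E !mnmE -/s.
  have [eq_li|neq_li] := eqVneq l i.
    by rewrite eq_li iS tpermL jS' card_j ji; have := le_card i; lia.
  have [eq_lj|neq_lj] := eqVneq l j.
    by rewrite eq_lj (negPf jS) tpermR (negPf iS').
  have sl : s l = l by rewrite /s tpermD // eq_sym.
  by rewrite sl in_S' sl card_lt.
rewrite negb_exists_in => /forall_inP S_succ.
have -> : S = [set i : 'I_n | (k.-1 <= i)%N].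
  apply: skip_mon_last => // i j iS ji; have := S_succ i iS.
  by rewrite negb_exists => /forallP/(_ j); rewrite ji eqxx negbK.
exists ((\prod_(i < n | (k.-1 <= i)%N) 'X_i) ^+ k); first exact: prod_last_vars_ideal.
rewrite mprodXE mpolyXn skip_mon_lastE.
have -> : ((\sum_(i < n | (k.-1 <= i)%N) U_(i)) *+ k =
    [multinom (if (k.-1 <= i)%N then k else 0%N) | i < n])%MM.
  apply/mnmP => i; rewrite mulmnE mnm_sumE mnmE big_mkcond (bigD1 i) //= big1.
    by rewrite mnm1E eqxx; case: ifP; rewrite ?mul1n.
  by move=> j neq_ji; rewrite mnm1E (negPf neq_ji) if_same.
by split=> [|a]; rewrite msuppX inE // => /eqP ->; rewrite eqxx.
Qed.

End SkipElements.

(** * Counting nonskip monomials *)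

Section Counting.
Variable r : nat.
Hypothesis r_gt0 : (0 < r)%N.

Lemma count_sum (T : Type) (P : pred T) (s : seq T) : count P s = (\sum_(x <- s) P x)%N.
Proof. by rewrite -sum1_count big_mkcond; apply: eq_bigr => x _; case: (P x). Qed.

Lemma sum_if_count (T : Type) (P : pred T) (s : seq T) x y :
  (\sum_(a <- s) (if P a then x else y) = count P s * x + (size s - count P s) * y)%N.
Proof.
rewrite -(count_predC P s) addKn.
elim: s => [|a s IHs]; first by rewrite big_nil.
by rewrite big_cons IHs /=; case: (P a) => /=; lia.
Qed.

Lemma count_iota_ltn c D : (c <= D)%N -> count (fun a => (a < c)%N) (iota 0 D) = c.
Proof.
move=> le_cD; rewrite -(subnKC le_cD) iotaD count_cat.
rewrite (eq_in_count (a2 := predT)); last by move=> a; rewrite mem_iota => /andP[_ ->].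
rewrite count_predT size_iota (eq_in_count (a2 := pred0)) ?count_pred0 ?addn0 // => a.
by rewrite mem_iota leqNgt => /andP[/negPf ->].
Qed.

Lemma count_class D j : (j.+1 * r <= D)%N ->
  count (fun a => a %/ r == j)%N (iota 0 D) = r.
Proof.
move=> le_jD; have := count_iota_ltn le_jD.
rewrite (count_sum _ (iota 0 D)) (eq_bigr (fun a => (a < j * r) + (a %/ r == j))%N).
  rewrite big_split /= -!count_sum count_iota_ltn ?mulSn.
    by rewrite addnC => /addIn.
  by apply: leq_trans le_jD; rewrite leq_mul2r leqnSn orbT.
move=> a _; rewrite -!ltn_divLR // ltnS.
by case: (ltngtP (a %/ r)%N j).
Qed.

Lemma count_classes D (T : seq nat) : uniq T -> {in T, forall j, (j.+1 * r <= D)%N} ->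
  count (fun a => (a %/ r)%N \in T) (iota 0 D) = (r * size T)%N.
Proof.
elim: T => [|j T IHT] /= => [_ _|/andP[jT uniq_T] le_D]; first by rewrite count_pred0 muln0.
rewrite count_sum (eq_bigr (fun a => (a %/ r == j) + ((a %/ r)%N \in T))%N).
  rewrite big_split /= -!count_sum count_class ?le_D ?mem_head // IHT ?mulnS //.
  by move=> i iT; apply: le_D; rewrite inE iT orbT.
by move=> a _; rewrite inE; case: eqP => // ->; rewrite (negPf jT).
Qed.

Fixpoint words D n : seq (seq nat) :=
  if n is n'.+1 then [seq rcons w a | w <- words D n', a <- iota 0 D] else [:: [::]].

Lemma mem_words D n w : (w \in words D n) = (size w == n) && all (fun a => a < D)%N w.
Proof.
elim: n w => [|n IHn] w; first by case: w => [|a w].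
apply/allpairsP/andP => [[[v a] /= [+ +]] ->|].
  rewrite IHn mem_iota => /andP[/eqP <- v_D] /= a_D.
  by rewrite size_rcons eqxx all_rcons a_D.
case/lastP: w => [[]//|v a]; rewrite size_rcons all_rcons eqSS => -[size_v /andP[a_D v_D]].
by exists (v, a); rewrite IHn mem_iota size_v v_D.
Qed.

Lemma words_uniq D n : uniq (words D n).
Proof.
elim: n => // n IHn; apply: allpairs_uniq => //; first exact: iota_uniq.
by move=> [v a] [w b] _ _ /= /rcons_inj.
Qed.

Lemma count_words D n (P : pred (seq nat)) :
  count P (words D n.+1) =
  (\sum_(w <- words D n) \sum_(a <- iota 0 D) P (rcons w a))%N.
Proof. by rewrite count_sum /= big_allpairs_dep. Qed.

(** The common recursion for two counts of words of length [n] over [D]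
    letters: the words that meet [u] given classes of [r] letters each, and the
    exponent sequences on which the greedy choice of a skip monomial passes over
    at least [u] variables. *)
Fixpoint cover_count D n u : nat :=
  if n is n'.+1 then
    (r * u * cover_count D n' u.-1 + (D - r * u) * cover_count D n' u)%N
  else (u == 0)%N.

Definition covers (T : seq nat) (w : seq nat) : bool :=
  all (fun j => j \in [seq (a %/ r)%N | a <- w]) T.

(** If the last letter is in a class of [T], for which there are [r * size T]
    choices, the letters before it need only meet the other classes of [T]. *)
Lemma count_covers D n (T : seq nat) :
    uniq T -> {in T, forall j, (j.+1 * r <= D)%N} ->
  count (covers T) (words D n) = cover_count D n (size T).
Proof.
elim: n T => [|n IHn] T uniq_T le_D /=; first by case: T uniq_T le_D.
have covers_rcons w a : covers T (rcons w a) = covers (rem (a %/ r)%N T) w.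
  rewrite /covers rem_filter // all_filter; apply: eq_all => j /=.
  by rewrite map_rcons mem_rcons inE; case: eqP.
rewrite count_words exchange_big /=.
rewrite (eq_bigr (fun a => if (a %/ r)%N \in T then cover_count D n (size T).-1
                           else cover_count D n (size T))) => [|a _].
  by rewrite sum_if_count count_classes // size_iota; case: (T) => [|j T'] //=; rewrite muln0.
rewrite -count_sum (eq_count (covers_rcons ^~ a)) IHn ?rem_uniq //.
  by case: ifPn => aT; [rewrite size_rem | rewrite rem_id].
by move=> j /mem_rem; apply: le_D.
Qed.

(** The number of variables that the greedy choice of a skip monomial passes
    over: having passed over [u] variables, it takes the next one if the
    exponent allows [r * u.+1]. *)
Definition unskipped (w : seq nat) : nat :=
  foldl (fun u a => u + (a < r * u.+1))%N 0%N w.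

Lemma unskipped_rcons w a :
  unskipped (rcons w a) = (unskipped w + (a < r * (unskipped w).+1))%N.
Proof. exact: foldl_rcons. Qed.

(** With [u.-1] variables passed over so far, [r * u] of the [D] values of the
    next exponent lead to [u]. *)
Lemma count_unskipped D n u : (r * u <= D)%N ->
  count (fun w => u <= unskipped w)%N (words D n) = cover_count D n u.
Proof.
elim: n u => [|n IHn] u le_uD; first by case: u le_uD.
have le_u1D : (r * u.-1 <= D)%N by apply: leq_trans le_uD; rewrite leq_mul2l leq_pred orbT.
rewrite count_words /= -(IHn _ le_uD) -(IHn _ le_u1D) ![count _ (words _ _)]count_sum.
rewrite !big_distrr -big_split; apply: eq_bigr => w _ /=; rewrite -count_sum.
under eq_count => a do rewrite unskipped_rcons.
have [le_uw|] := leqP u (unskipped w).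
  rewrite (leq_trans (leq_pred u) le_uw) !muln1 subnKC // -[RHS](size_iota 0) -count_predT.
  by apply: eq_count => a; rewrite (leq_trans le_uw) ?leq_addr.
case: u le_uD le_u1D => // u le_uD _; rewrite ltnS muln0 addn0 leq_eqVlt.
case/orP => [/eqP->|lt_wu].
  rewrite leqnn muln1 -[RHS](count_iota_ltn le_uD); apply: eq_count => a.
  by case: (a < _)%N; rewrite ?addn1 ?addn0 ?ltnn ?leqnn.
rewrite leqNgt lt_wu muln0 -[RHS](count_pred0 (iota 0 D)); apply: eq_count => a /=.
by apply/negbTE; rewrite -ltnNge ltnS; case: (a < _)%N; rewrite ?addn1 ?addn0 // ltnW.
Qed.

End Counting.

(** The greedy choice realises a skip monomial as soon as it takes [n - k + 1]
    variables; the exponents of a skip monomial only look at smaller indices,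
    so its first [n - k + 1] choices suffice. *)
Lemma unskipped_nonskip n k r (m : 'X_{1..n}) : (k <= n)%N ->
    (forall S : {set 'I_n}, #|S| = (n - k).+1 -> ~~ (skip_mon S *+ r <= m)%MM) ->
  (k <= unskipped r m)%N.
Proof.
move=> le_kn nonskip_m; rewrite leqNgt; apply/negP => lt_uk.
pose u i := unskipped r (take i m).
have size_m : size m = n by rewrite size_tuple.
have u_succ (i : 'I_n) : u i.+1 = (u i + (m i < r * (u i).+1))%N.
  by rewrite /u (take_nth 0%N) ?size_m // unskipped_rcons -mnm_nth.
pose S := [set i : 'I_n | (r * (u i).+1 <= m i)%N].
(* Among the first [i] variables the choice takes [c i] and passes over [u i]. *)
pose c i := #|[set l in S | (l < i)%N]|.
have c_succ (i : 'I_n) : c i.+1 = ((i \in S) + c i)%N.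
  have -> : c i.+1 = #|[set l in [set i] | i \in S] :|: [set l in S | (l < i)%N]|.
    apply: eq_card => l; rewrite !inE ltnS [(l <= i)%N]leq_eqVlt.
    have [/val_inj ->|neq_li] := eqVneq (l : nat) i; first by rewrite eqxx ltnn andbT andbF orbF.
    by have [eq_li|] := eqVneq l i; first by rewrite eq_li eqxx in neq_li.
  rewrite cardsU; case: (i \in S); last first.
    have -> : [set l in [set i] | false] = set0 by apply/setP => l; rewrite !inE andbF.
    by rewrite set0I cards0 subn0.
  have -> : [set l in [set i] | true] = [set i] by apply/setP => l; rewrite !inE andbT.
  rewrite cards1 (_ : [set i] :&: _ = set0) ?cards0 ?subn0 //.
  by apply/setP => l; rewrite !inE; case: eqP => // ->; rewrite ltnn andbF.
have cu i : (i <= n)%N -> (c i + u i)%N = i.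
  elim: i => [|i IHi] lt_in.
    rewrite /u take0 addn0; apply: eq_card0 => l; by rewrite !inE andbF.
  have := IHi (ltnW lt_in); rewrite (c_succ (Ordinal lt_in)) (u_succ (Ordinal lt_in)) /=.
  by rewrite inE /= ltnNge; case: (_ <= _)%N => /=; lia.
have ex_c : exists i, ((n - k).+1 <= c i)%N.
  exists n; have := cu n (leqnn n); rewrite /u -{2}size_m take_size.
  by move: lt_uk le_kn; lia.
case: (ex_minnP ex_c) => i le_ci min_i.
have le_in : (i <= n)%N.
  apply: min_i; have := cu n (leqnn n); rewrite /u -{2}size_m take_size.
  by move: lt_uk le_kn; lia.
have eq_ci : c i = (n - k).+1.
  apply/eqP; rewrite eqn_leq le_ci andbT.
  case: i le_in le_ci min_i => [|i] lt_in le_ci min_i.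
    by move: le_ci; have := cu 0%N (leq0n _); lia.
  have := min_i i; rewrite (c_succ (Ordinal lt_in)) /=.
  by case: (_ \in S) => /=; lia.
move/negP: (nonskip_m [set l in S | (l < i)%N] eq_ci); apply.
apply/mnm_lepP => j; rewrite mulmnE mnmE inE; case: ifP => // /andP[jS lt_ji].
have -> : #|[set l in [set l in S | (l < i)%N] | (l < j)%N]| = c j.
  apply: eq_card => l; rewrite !inE -andbA; congr (_ && _).
  by case lt_lj: (l < j)%N; rewrite ?andbF ?andbT // (ltn_trans lt_lj).
move: jS; rewrite inE mulnC; have := cu j (ltnW (ltn_ord j)) => eq_j.
by have -> : (j.+1 - c j)%N = (u j).+1 by lia.
Qed.

(** * Polynomials vanishing on a finite set of points *)

Section Footprint.
Variables (F : fieldType) (n : nat) (pts : seq (n.-tuple F)) (B : seq 'X_{1..n}).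
Implicit Types (p q g h : {mpoly F[n]}) (m a b : 'X_{1..n}).

Definition vanishes p := {in pts, forall y, p.@[tnth y] = 0}.

Hypotheses (uniq_pts : uniq pts) (uniq_B : uniq B) (le_B_pts : (size B <= size pts)%N).
Hypothesis reducible : forall m, m \notin B -> exists2 g, vanishes g & deglex_lead g m.

Let reduces_below (P : pred 'X_{1..n}) p :=
  exists2 q, {in msupp q, forall b, b \in B /\ P b} & vanishes (p - q).

Let reduces_below0 P : reduces_below P 0.
Proof. by exists 0 => [b|y _]; rewrite ?msupp0 // subrr meval0. Qed.

Let reduces_belowD P p q : reduces_below P p -> reduces_below P q -> reduces_below P (p + q).
Proof.
move=> [p' Bp' vp'] [q' Bq' vq']; exists (p' + q') => [b /msuppD_le|y y_pts].
  by rewrite mem_cat => /orP[/Bp'|/Bq'].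
by rewrite opprD addrACA mevalD vp' // vq' // addr0.
Qed.

Let reduces_belowZ P c p : reduces_below P p -> reduces_below P (c *: p).
Proof.
move=> [p' Bp' vp']; exists (c *: p') => [b /msuppZ_le/Bp' //|y y_pts].
by rewrite -scalerBr mevalZ vp' ?mulr0.
Qed.

Let reduces_below_poly P p :
  {in msupp p, forall b, reduces_below P 'X_[b]} -> reduces_below P p.
Proof.
move=> red_p; rewrite (mpolyE p) big_seq.
apply: big_ind => [|p1 p2|b /red_p]; [exact: reduces_below0 | exact: reduces_belowD |].
exact: reduces_belowZ.
Qed.

Let sub_lead g m : deglex_lead g m ->
  {in msupp (g - g@_m *: 'X_[m]), forall b, deglex_lt b m}.
Proof.
move=> [_ max_m] b; rewrite mcoeff_msupp mcoeffB mcoeffZ mcoeffX.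
have [<-|neq_mb] := eqVneq m b; first by rewrite mulr1 subrr eqxx.
by rewrite mulr0 subr0 -mcoeff_msupp => /max_m; apply; rewrite eq_sym.
Qed.

Let reduces_belowW (P Q : pred 'X_{1..n}) p :
  subpred P Q -> reduces_below P p -> reduces_below Q p.
Proof. by move=> subPQ [q Bq vq]; exists q => // b /Bq[-> /subPQ]. Qed.

Let reduces_belowX m : reduces_below [pred b | (b == m) || deglex_lt b m] 'X_[m].
Proof.
elim/deglex_ind: m => m IHm; have [mB|/reducible[g vg lead_g]] := boolP (m \in B).
  exists 'X_[m] => [b|y _]; last by rewrite subrr meval0.
  by rewrite msuppX mem_seq1 => /eqP ->; rewrite /= eqxx.
have gm_neq0 : g@_m != 0 by rewrite -mcoeff_msupp; case: lead_g.
have [b|q Bq vq] := @reduces_below_poly [pred b | deglex_lt b m] (g - g@_m *: 'X_[m]).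
  move=> /(sub_lead lead_g) lt_bm; apply: reduces_belowW (IHm b lt_bm) => a /=.
  by case/orP => [/eqP->|/deglex_lt_trans]; last exact.
exists (- (g@_m)^-1 *: q) => [b /msuppZ_le/Bq[-> /= lt_b]|y y_pts]; first by rewrite lt_b orbT.
have := vq y y_pts; rewrite !mevalB vg // !mevalZ sub0r => /eqP.
rewrite subr_eq0 => /eqP <-; rewrite mulrN mulNr opprK mulKf // subrr //.
Qed.

(** The monomials of [B] span the functions on [pts], since every function on
    [pts] is polynomial, and there are at most as many of them as points. *)
Let B_independent h : {subset msupp h <= B} -> vanishes h -> h = 0.
Proof.
move=> sub_hB vh.
have sepP (y y' : n.-tuple F) : y != y' -> exists2 p, p.@[tnth y] = 1 & p.@[tnth y'] = 0.
  move=> neq_y; have [i neq_i] : exists i, tnth y i != tnth y' i.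
    apply/existsP; apply: contraNT neq_y => /existsPn eq_y.
    by apply/eqP/eq_from_tnth => i; apply/eqP; rewrite -[_ == _]negbK eq_y.
  exists ((tnth y i - tnth y' i)^-1 *: ('X_i - (tnth y' i)%:MP)).
    by rewrite mevalZ mevalB mevalXU mevalC mulVf // subr_eq0.
  by rewrite mevalZ mevalB mevalXU mevalC subrr mulr0.
have deltaP (y : n.-tuple F) (s : seq (n.-tuple F)) :
    exists2 p, p.@[tnth y] = 1 & {in s, forall y', y' != y -> p.@[tnth y'] = 0}.
  elim: s => [|z s [p p1 p0]]; first by exists 1; rewrite ?meval1.
  have [eq_zy|neq_zy] := eqVneq z y.
    exists p => // y'; rewrite inE => /orP[/eqP->|/p0 //].
    by rewrite eq_zy eqxx.
  rewrite eq_sym in neq_zy; have [q q1 q0] := sepP _ _ neq_zy.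
  exists (p * q) => [|y']; first by rewrite mevalM p1 q1 mulr1.
  rewrite inE mevalM => /orP[/eqP->|/p0 p0y' /p0y' ->]; last by rewrite mul0r.
  by rewrite q0 mulr0.
pose mon (i : 'I_(size B)) := nth 0%MM B i; pose pt j := nth [tuple 0 | _ < n] pts j.
have expand q : {subset msupp q <= B} -> q = \sum_i q@_(mon i) *: 'X_[mon i].
  move=> sub_qB; apply/mpolyP => b.
  rewrite -(big_mkord predT (fun i => q@_(nth 0%MM B i) *: 'X_[nth 0%MM B i])).
  rewrite -(big_nth 0%MM predT (fun a => q@_a *: 'X_[a])) raddf_sum /=.
  have [b_B|b_B] := boolP (b \in B).
    rewrite (bigD1_seq b) //= mcoeffZ mcoeffX eqxx mulr1 big1 ?addr0 // => a neq_ab.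
    by rewrite mcoeffZ mcoeffX (negPf neq_ab) mulr0.
  rewrite big_seq big1 => [|a a_B]; last first.
    rewrite mcoeffZ mcoeffX; case: eqP => [eq_ab|]; last by rewrite mulr0.
    by rewrite -eq_ab a_B in b_B.
  by apply: memN_msupp_eq0; apply: contra b_B; apply: sub_qB.
pose E := \matrix_(i < size B, j < size pts) ('X_[mon i] : {mpoly F[n]}).@[tnth (pt j)].
have evalE q (j : 'I_(size pts)) : {subset msupp q <= B} ->
    q.@[tnth (pt j)] = ((\row_i q@_(mon i)) *m E) 0 j.
  move=> sub_qB; rewrite {1}(expand q sub_qB) raddf_sum mxE.
  by apply: eq_bigr => i _; rewrite /= mevalZ !mxE.
have pt_mem (j : 'I_(size pts)) : pt j \in pts by apply: mem_nth.
have [C CE] : exists C : 'M_(size pts, size B), C *m E = 1%:M.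
  have /fin_all_exists[c Dc] (i : 'I_(size pts)) :
      exists c : 'rV_(size B), c *m E = delta_mx 0 i.
    have [p p1 p0] := deltaP (pt i) pts.
    have [q Bq vq] : reduces_below predT p.
      apply: reduces_below_poly => b _; apply: reduces_belowW (reduces_belowX b) => //.
    exists (\row_i q@_(mon i)); apply/rowP => j.
    rewrite -evalE => [|b /Bq[]//]; have /eqP := vq _ (pt_mem j).
    rewrite mevalB subr_eq0 => /eqP <-; rewrite mxE eqxx /=.
    have [->|neq_ji] := eqVneq j i; first exact: p1.
    by apply: p0; rewrite ?pt_mem // nth_uniq.
  exists (\matrix_i c i); apply/row_matrixP => i.
  by rewrite row_mul rowK Dc row1.
(* [E] has full column rank, and no more rows than columns. *)
have free_E : row_free E.
  have := mxrankS (submxMl C E); rewrite CE mxrank1 => le_ME.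
  by rewrite /row_free eqn_leq rank_leq_row (leq_trans le_B_pts).
have : (\row_i h@_(mon i)) *m E = 0.
  by apply/rowP => j; rewrite -evalE // vh ?pt_mem // mxE.
move/eqP; rewrite mulmx_free_eq0 // => /eqP/rowP h0.
by rewrite (expand h sub_hB) big1 // => i _; have := h0 i; rewrite !mxE => ->; rewrite scale0r.
Qed.

(** A polynomial led by [l] in [B] would reduce to a nontrivial relation
    between the functions that the monomials of [B] induce on [pts]. *)
Lemma footprint g l : vanishes g -> deglex_lead g l -> l \notin B.
Proof.
move=> vg lead_g; apply/negP => l_B.
have [b|q Bq vq] := @reduces_below_poly [pred b | deglex_lt b l] (g - g@_l *: 'X_[l]).
  move=> /(sub_lead lead_g) lt_bl; apply: reduces_belowW (reduces_belowX b) => a /=.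
  by case/orP => [/eqP->|/deglex_lt_trans]; last exact.
have gl_neq0 : g@_l != 0 by rewrite -mcoeff_msupp; case: lead_g.
have h0 : g@_l *: 'X_[l] + q = 0.
  apply: B_independent => [b /msuppD_le|y y_pts].
    rewrite mem_cat => /orP[/msuppZ_le|/Bq[]//].
    by rewrite msuppX mem_seq1 => /eqP ->.
  have := vq y y_pts; rewrite !mevalB mevalD vg // sub0r => /eqP.
  by rewrite subr_eq0 => /eqP <-; rewrite subrr.
have ql0 : q@_l = 0.
  by apply: memN_msupp_eq0; apply/negP => /Bq[_]; rewrite /= deglex_lt_irr.
have := congr1 (mcoeff l) h0; rewrite mcoeffD mcoeffZ mcoeffX eqxx mulr1 ql0 addr0 mcoeff0.
by move/eqP; rewrite (negPf gl_neq0).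
Qed.

End Footprint.

(** * Deforming the generators *)

Section Deformation.
Variables (F : fieldType) (n : nat) (pts : seq (n.-tuple F)).
Implicit Types (f g c : {mpoly F[n]}) (m : 'X_{1..n}).

(** The ideal of top-degree parts of polynomials vanishing on [pts]; asking this
    of each homogeneous component makes it closed under addition. *)
Definition top_vanishing f := forall d, exists2 f', vanishes pts f' &
  forall m, (d <= mdeg m)%N -> f'@_m = if mdeg m == d then f@_m else 0.

Lemma top_vanishing0 : top_vanishing 0.
Proof. by move=> d; exists 0 => [y _|m _]; rewrite ?meval0 // mcoeff0 if_same. Qed.

Lemma top_vanishingD f g : top_vanishing f -> top_vanishing g -> top_vanishing (f + g).
Proof.
move=> tf tg d; have [f' vf' Df'] := tf d; have [g' vg' Dg'] := tg d.
exists (f' + g') => [y y_pts|m le_dm]; first by rewrite mevalD vf' // vg' // addr0.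
by rewrite !mcoeffD Df' // Dg' //; case: ifP => _; rewrite ?addr0.
Qed.

Lemma top_vanishingZ (a : F) f : top_vanishing f -> top_vanishing (a *: f).
Proof.
move=> tf d; have [f' vf' Df'] := tf d.
exists (a *: f') => [y y_pts|m le_dm]; first by rewrite mevalZ vf' // mulr0.
by rewrite !mcoeffZ Df' //; case: ifP => _; rewrite ?mulr0.
Qed.

Lemma mcoeffMX_if f m b :
  (f * 'X_[m])@_b = if (m <= b)%MM then f@_(b - m)%MM else 0.
Proof.
case: ifPn => le_mb; first by rewrite -{1}(submK le_mb) addmC mcoeffMX.
apply: memN_msupp_eq0; apply: contra le_mb; rewrite (perm_mem (msuppMX _ _)).
by case/mapP => b' _ ->; apply: lem_addr.
Qed.

(** By linearity [c] may be a monomial; then [c * g] is homogeneous and is the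
    top-degree part of [c * g']. *)
Lemma top_vanishing_mul e g g' c :
    g \is e.-homog -> vanishes pts g' ->
    (forall m, (e <= mdeg m)%N -> g'@_m = g@_m) ->
  top_vanishing (c * g).
Proof.
move=> hom_g vg' Dg'.
elim/mpolyind: c => [|a m c _ _ IHc]; first by rewrite mul0r; apply: top_vanishing0.
rewrite mulrDl -scalerAl; apply: top_vanishingD IHc; apply: top_vanishingZ => d.
have hom_gX : g * 'X_[m] \is (e + mdeg m).-homog by apply: dhomogM => //; rewrite dhomogX.
rewrite mulrC; have [eq_d|neq_d] := eqVneq (e + mdeg m)%N d; last first.
  exists 0 => [y _|b _]; rewrite ?meval0 // mcoeff0; case: eqP => // eq_bd.
  by rewrite (dhomog_nemf_coeff hom_gX) //= eq_bd eq_sym.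
exists (g' * 'X_[m]) => [y y_pts|b le_db]; first by rewrite mevalM vg' ?mul0r.
have -> : (g' * 'X_[m])@_b = (g * 'X_[m])@_b.
  rewrite !mcoeffMX_if; case: ifP => // le_mb; apply: Dg'.
  rewrite -(leq_add2r (mdeg m)) -mdegD submK // eq_d //.
case: eqP => // /eqP neq_bd; rewrite (dhomog_nemf_coeff hom_gX) //.
by rewrite eq_d.
Qed.

Lemma top_vanishing_lead f l : top_vanishing f -> lex_lead f l ->
  exists2 g, vanishes pts g & deglex_lead g l.
Proof.
move=> tf [l_f max_l]; have [g vg Dg] := tf (mdeg l); exists g => //; split.
  by rewrite mcoeff_msupp Dg // eqxx -mcoeff_msupp.
move=> m m_g neq_ml; rewrite /deglex_lt.
case: (ltngtP (mdeg m) (mdeg l)) => //= [lt_lm|eq_lm].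
  by move: m_g; rewrite mcoeff_msupp Dg ?gtn_eqF ?eqxx // ltnW.
by move: m_g; rewrite mcoeff_msupp Dg ?eq_lm // eqxx -mcoeff_msupp => /max_l; apply.
Qed.

Lemma top_vanishing_pow c (i : 'I_n) (s : seq F) :
    {in pts, forall y : n.-tuple F, tnth y i \in s} ->
  top_vanishing (c * 'X_i ^+ size s).
Proof.
move=> pts_s; pose P := \prod_(z <- s) ('X - z%:P).
have sizeP : size P = (size s).+1 by rewrite size_prod_XsubC.
have P_lead : P`_(size s) = 1.
  have : P \is monic by apply: monic_prod_XsubC.
  by rewrite monicE lead_coefE sizeP => /eqP.
apply: (@top_vanishing_mul (size s) _ (\sum_(l < (size s).+1) P`_l *: 'X_i ^+ l)).
- by rewrite mpolyXn dhomogX /= mdegMn mdeg1 mul1n.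
- move=> y y_pts; rewrite raddf_sum /=.
  have : root P (tnth y i) by rewrite root_prod_XsubC pts_s.
  move=> /rootP P0; apply: etrans P0; rewrite horner_coef sizeP; apply: eq_bigr => l _.
  by rewrite mevalZ rmorphXn /= mevalXU.
- move=> m le_m; rewrite big_ord_recr /= P_lead scale1r mcoeffD raddf_sum big1 ?add0r //=.
  move=> l _; rewrite mcoeffZ mpolyXn mcoeffX; case: eqP => [eq_lm|]; last by rewrite mulr0.
  by move: le_m; rewrite -eq_lm mdegMn mdeg1 mul1n leqNgt ltn_ord.
Qed.

Variable r : nat.

Lemma dhomog_esym_pow d : esym_pow F n r d \is (d * r).-homog.
Proof.
rewrite /esym_pow comp_mpoly_powE big_seq; apply: rpred_sum => m m_e.
apply: dhomogZ; rewrite dhomogX /= mdegMn.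
by rewrite (dhomog_mf (dhomog_mesym _ _ _) m_e).
Qed.

Lemma meval_esym_pow (y : n.-tuple F) d : (d <= n)%N ->
  (esym_pow F n r d).@[tnth y] =
  (-1) ^+ d * (\prod_(i < n) ('X - (tnth y i ^+ r)%:P))`_(n - d).
Proof.
rewrite -ltnS => lt_d; have := mroots_coeff [tuple tnth y i ^+ r | i < n] (Ordinal lt_d).
rewrite big_map big_enum /= => ->; rewrite mulrA -expr2 sqrr_sign mul1r.
rewrite /esym_pow comp_mpoly_meval; apply: meval_eq => i.
by rewrite !tnth_mktuple rmorphXn /= mevalXU.
Qed.

(** On the points where every node occurs among the [y_i ^+ r], the product of
    the [T - y_i ^+ r] is a multiple of the product [C] of the [T - z], so the
    coefficients of its remainder modulo [C] are polynomials vanishing there.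
    The coefficient of [T ^+ j] has top-degree part [e_(n - j)], because the
    remainder of [T ^+ i] is [T ^+ i] itself for [i < size nodes]. *)
Lemma top_vanishing_esym c (nodes : seq F) j :
    (0 < r)%N -> uniq nodes -> (j < size nodes)%N -> (size nodes <= n)%N ->
    {in pts, forall y : n.-tuple F, {subset nodes <= [seq tnth y i ^+ r | i <- enum 'I_n]}} ->
  top_vanishing (c * esym_pow F n r (n - j)).
Proof.
move=> r_gt0 uniq_nodes lt_j le_n pts_nodes.
pose C := \prod_(z <- nodes) ('X - z%:P).
have sizeC : size C = (size nodes).+1 by rewrite size_prod_XsubC.
pose rem i := ('X^i %% C)`_j.
have le_jn : (j <= n)%N by apply: leq_trans le_n; apply: ltnW.
apply: (@top_vanishing_mul ((n - j) * r) _ ((-1) ^+ (n - j) *: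
          \sum_(d < n.+1) ((-1) ^+ d * rem (n - d)%N) *: esym_pow F n r d)).
- exact: dhomog_esym_pow.
- move=> y y_pts; rewrite mevalZ raddf_sum /=.
  pose P := \prod_(i < n) ('X - (tnth y i ^+ r)%:P).
  have sizeP : size P = n.+1.
    by rewrite /P -big_enum size_prod_XsubC size_enum_ord.
  have CP : C %| P.
    apply: uniq_roots_dvdp; last by rewrite uniq_rootsE.
    apply/allP => z /(pts_nodes _ y_pts) /mapP[i _ ->].
    rewrite /P rootE horner_prod; apply/prodf_eq0; exists i => //.
    by rewrite !hornerE subrr.
  have modP : P %% C = \sum_(i < n.+1) P`_i *: ('X^i %% C).
    have {1}-> : P = \sum_(i < n.+1) P`_i *: 'X^i.
      by rewrite -sizeP -poly_def coefK.
    rewrite (big_morph (fun q => q %% C) (modpD C) (mod0p C)).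
    by apply: eq_bigr => i _; rewrite modpZl.
  have := congr1 (fun q : {poly F} => q`_j) modP.
  rewrite (eqP CP) coef0 coef_sum => P0.
  suff sum0 : \sum_(d < n.+1) (((-1) ^+ d * rem (n - d)%N) *: esym_pow F n r d).@[tnth y] = 0.
    by rewrite sum0 mulr0.
  apply: etrans (esym P0); rewrite [RHS](reindex_inj rev_ord_inj) /=.
  apply: eq_bigr => d _; have le_dn : (d <= n)%N by rewrite -ltnS.
  rewrite subSS coefZ mevalZ meval_esym_pow // -/P -/(rem _) mulrACA.
  by rewrite -expr2 sqrr_sign mul1r mulrC.
- move=> m le_m; have lt_jn1 : (n - j < n.+1)%N by rewrite ltnS leq_subr.
  rewrite mcoeffZ raddf_sum (bigD1 (Ordinal lt_jn1)) //= big1 ?addr0.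
    have rem_j : rem j = 1.
      by rewrite /rem modp_small ?coefXn ?eqxx // size_polyXn sizeC ltnS.
    by rewrite subKn // rem_j mulr1 mcoeffZ mulrA -expr2 sqrr_sign mul1r.
  move=> d; rewrite -val_eqE /= => neq_d; rewrite mcoeffZ.
  have le_dn : (d <= n)%N by rewrite -ltnS.
  have [lt_d|le_d] := ltnP d (n - j).
    rewrite (dhomog_nemf_coeff (dhomog_esym_pow d)) ?mulr0 //=.
    by rewrite gtn_eqF // (leq_trans _ le_m) // ltn_pmul2r.
  rewrite /rem modp_small; last by rewrite size_polyXn sizeC ltnS; lia.
  by rewrite coefXn (_ : j == n - d = false)%N ?mulr0 ?mul0r //; lia.
Qed.

End Deformation.

(** * The standard monomials *)

Lemma unity_roots_exist (F : numClosedFieldType) r : (0 < r)%N ->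
  exists2 s : seq F, uniq s /\ size s = r & {in s, forall z, z ^+ r = 1}.
Proof.
move=> r_gt0; have [s Ds] := closed_field_poly_normal ('X^r - 1 : {poly F}).
rewrite (monicP _) ?monicXnsubC // scale1r in Ds; exists s; last first.
  move=> z; rewrite -root_prod_XsubC -Ds => /rootP/eqP.
  by rewrite !hornerE subr_eq0 => /eqP.
split; last by apply: succn_inj; rewrite -(size_prod_XsubC s id) -Ds size_XnsubC.
by rewrite -separable_prod_XsubC -Ds separable_Xn_sub_1 // pnatr_eq0 -lt0n.
Qed.

Lemma mnm1_mul_le n (i : 'I_n) d (m : 'X_{1..n}) : (U_(i) *+ d <= m)%MM = (d <= m i)%N.
Proof.
apply/mnm_lepP/idP => [/(_ i)|le_dm j]; rewrite mulmnE mnm1E; first by rewrite eqxx mul1n.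
by case: eqP => [<-|_]; rewrite ?mul1n ?mul0n.
Qed.

Section StandardMonomials.
Variables (F : numClosedFieldType) (n k r eps : nat).
Hypotheses (r_gt0 : (0 < r)%N) (k_gt0 : (0 < k)%N) (le_kn : (k <= n)%N) (eps1 : (eps <= 1)%N).

Let D := (k * r + eps)%N.
Let gs := [seq 'X_i ^+ D | i <- enum 'I_n] ++ esym_gens F n k r.
Let inI : {mpoly F[n]} -> Prop := ideal_gen gs.

(** For [eps = 1] these are the nonskip monomials, for [eps = 0] the strongly
    nonskip ones. *)
Definition bounded_nonskip (m : 'X_{1..n}) : bool :=
  [forall i : 'I_n, (m i < D)%N]
  && [forall (S : {set 'I_n} | #|S| == (n - k).+1), ~~ (skip_mon S *+ r <= m)%MM].

Lemma bounded_nonskip_le a b : (a <= b)%MM -> bounded_nonskip b -> bounded_nonskip a.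
Proof.
move=> /mnm_lepP le_ab /andP[/forallP b_D /forall_inP b_S]; apply/andP; split.
  by apply/forallP => i; apply: leq_ltn_trans (b_D i).
by apply/forall_inP => S /b_S; apply: contra => /lepm_trans; apply; apply/mnm_lepP.
Qed.

Lemma lead_of_bounded_nonskip (m : 'X_{1..n}) :
  ~~ bounded_nonskip m -> exists2 f, inI f & lex_lead f m.
Proof.
have lift f a : inI f -> lex_lead f a -> (a <= m)%MM -> exists2 f, inI f & lex_lead f m.
  move=> If lead_f le_am; exists ('X_[m - a] * f); first exact: ideal_genM.
  by rewrite mulrC -{2}(submK le_am); apply: lex_lead_mulX.
rewrite negb_and => /orP[/forallPn [j]|/forall_inPn[S /eqP card_S]].
  rewrite -leqNgt => le_Dm; apply: (lift ('X_j ^+ D) (U_(j) *+ D)%MM).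
  - apply: ideal_gen_mem; rewrite mem_cat; apply/orP; left.
    by apply/mapP; exists j; rewrite ?mem_enum.
  - by rewrite mpolyXn; split=> [|b]; rewrite msuppX mem_seq1 // => /eqP ->; rewrite eqxx.
  - by rewrite mnm1_mul_le.
rewrite negbK => le_Sm; have [f If lead_f] := skip_mon_lead F k_gt0 le_kn card_S.
apply: (lift (f \mPo [tuple 'X_i ^+ r | i < n])) le_Sm; last exact: lex_lead_comp_pow.
elim/ideal_gen_ind: If => [|p q Ip Iq|c g /mapP[j j_k ->]].
- by rewrite comp_mpoly0; apply: ideal_gen0.
- by rewrite comp_mpolyD; apply: ideal_genD.
- rewrite rmorphM; apply/ideal_genM/ideal_gen_mem; rewrite mem_cat.
  by apply/orP; right; apply/mapP; exists j.
Qed.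

Let mon (w : seq nat) : 'X_{1..n} := [multinom nth 0%N w i | i < n].

Let mon_inj : {in words D n &, injective mon}.
Proof.
move=> v w; rewrite !mem_words => /andP[/eqP size_v _] /andP[/eqP size_w _] /mnmP eq_vw.
apply: (@eq_from_nth _ 0%N) => [|i]; rewrite size_v ?size_w // => lt_in.
by have := eq_vw (Ordinal lt_in); rewrite !mnmE.
Qed.

Let nonskips := [seq mon w | w <- words D n & bounded_nonskip (mon w)].

Let mem_nonskips m : (m \in nonskips) = bounded_nonskip m.
Proof.
apply/mapP/idP => [[w + ->]|nonskip_m]; first by rewrite mem_filter => /andP[].
have mon_m : mon m = m by apply/mnmP => i; rewrite mnmE -mnm_nth.
exists (m : seq nat); rewrite // mem_filter mon_m nonskip_m mem_words size_tuple eqxx /=.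
apply/(all_nthP 0%N) => i; rewrite size_tuple => lt_in.
by case/andP: nonskip_m => /forallP/(_ (Ordinal lt_in)); rewrite (mnm_nth 0%N).
Qed.

Let size_nonskips : (size nonskips <= cover_count r D n k)%N.
Proof.
rewrite size_map size_filter -count_unskipped; last by rewrite mulnC leq_addr.
rewrite -!size_filter; apply: uniq_leq_size; first by rewrite filter_uniq ?words_uniq.
move=> w; rewrite !mem_filter => /andP[/andP[_ /forall_inP nonskip_w] w_words].
rewrite w_words andbT; have eq_w : mon w = w :> seq nat.
  move: w_words; rewrite mem_words => /andP[/eqP size_w _].
  apply: (@eq_from_nth _ 0%N) => [|i]; rewrite size_tuple ?size_w // => lt_in.
  by rewrite -(mnm_nth 0%N (mon w) (Ordinal lt_in)) mnmE.
by rewrite -eq_w; apply: unskipped_nonskip => // S /eqP; apply: nonskip_w.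
Qed.

(** The points: letter [a < k * r] of a word stands for an [r]-th root of the
    node [(a %/ r).+1 ^ r], and letter [k * r], available for [eps = 1] only,
    for [0]; the words that meet every node are as many as the nonskip
    monomials. *)
Lemma lead_not_bounded_nonskip f l : inI f -> lex_lead f l -> ~~ bounded_nonskip l.
Proof.
move=> If lead_f; have [rs [uniq_rs size_rs] rs1] := unity_roots_exist F r_gt0.
pose letter a : F := if (a < k * r)%N then (a %/ r).+1%:R * rs`_(a %% r) else 0.
have letterX a : (a < k * r)%N -> letter a ^+ r = (a %/ r).+1%:R ^+ r.
  move=> lt_a; rewrite /letter lt_a exprMn (rs1 rs`_(a %% r)) ?mulr1 //.
  by apply: mem_nth; rewrite size_rs ltn_mod.
have node_inj : injective (fun j => j.+1%:R ^+ r : F).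
  move=> i j /= /eqP; rewrite -!natrX eqr_nat eqn_exp2r //.
  by rewrite eqSS => /eqP.
(* Nodes are distinct, so equal letters have equal class; then they are the same
   root of unity times the same nonzero number. *)
have letter_neq0 a : (a < k * r)%N -> letter a != 0.
  move=> lt_a; apply: contraTneq isT => letter0; have := letterX a lt_a.
  by move/eqP; rewrite letter0 expr0n gtn_eqF // eq_sym expf_eq0 r_gt0 pnatr_eq0.
have letter_inj : {in iota 0 D &, injective letter}.
  move=> a b; rewrite !mem_iota /= => a_D b_D.
  have [lt_a|le_a] := ltnP a (k * r); have [lt_b|le_b] := ltnP b (k * r).
  - move=> eq_ab; have eq_div : (a %/ r = b %/ r)%N.
      by apply: node_inj; rewrite -!letterX // eq_ab.
    move: eq_ab; rewrite /letter lt_a lt_b eq_div => /mulfI.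
    rewrite pnatr_eq0 => /(_ isT) /eqP; rewrite nth_uniq ?size_rs ?ltn_mod // => /eqP eq_mod.
    by rewrite (divn_eq a r) (divn_eq b r) eq_div eq_mod.
  - by move=> eq_ab; have := letter_neq0 a lt_a; rewrite eq_ab /letter ltnNge le_b eqxx.
  - by move=> eq_ab; have := letter_neq0 b lt_b; rewrite -eq_ab /letter ltnNge le_a eqxx.
  - by move=> _; move: a_D b_D le_a le_b eps1; rewrite /D; lia.
pose pt (w : seq nat) := [tuple letter (nth 0%N w i) | i < n].
pose pts := [seq pt w | w <- words D n & covers r (iota 0 k) w].
have word_letter w (i : 'I_n) : w \in words D n -> nth 0%N w i \in iota 0 D.
  rewrite mem_words mem_iota => /andP[/eqP size_w /allP w_D].
  by apply/w_D/mem_nth; rewrite size_w.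
have uniq_pts : uniq pts.
  rewrite map_inj_in_uniq ?filter_uniq ?words_uniq // => v w.
  rewrite !mem_filter => /andP[_ v_words] /andP[_ w_words] eq_vw.
  apply: mon_inj => //; apply/mnmP => i; rewrite !mnmE.
  apply: letter_inj; rewrite ?word_letter //.
  by have := congr1 (fun t => tnth t i) eq_vw; rewrite !tnth_mktuple.
have size_pts : size pts = cover_count r D n k.
  rewrite size_map size_filter count_covers ?size_iota ?iota_uniq // => j.
  rewrite mem_iota => /= lt_jk; apply: leq_trans (leq_addr _ _).
  by rewrite leq_mul2r lt_jk orbT.
have pts_top g : inI g -> top_vanishing pts g.
  elim/ideal_gen_ind => [|p q|c h]; [exact: top_vanishing0 | exact: top_vanishingD |].
  rewrite mem_cat => /orP[/mapP[i _ ->]|/mapP[j]].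
    rewrite -{1}(size_iota 0 D) -(size_map letter); apply: top_vanishing_pow.
    move=> y /mapP[w]; rewrite mem_filter => /andP[_ w_words] ->.
    by rewrite tnth_mktuple map_f // word_letter.
  rewrite mem_iota => /= lt_jk ->.
  apply: (@top_vanishing_esym _ _ _ _ _ [seq j.+1%:R ^+ r | j <- iota 0 k]) => //.
  - by rewrite (map_inj_uniq node_inj) iota_uniq.
  - by rewrite size_map size_iota.
  - by rewrite size_map size_iota.
  move=> y /mapP[w]; rewrite mem_filter => /andP[/allP cover_w w_words] -> z /mapP[u u_k ->].
  have /mapP[a a_w Du] := cover_w u u_k.
  have size_w : size w = n by move: w_words; rewrite mem_words => /andP[/eqP].
  have lt_in : (index a w < n)%N by rewrite -size_w index_mem.
  apply/mapP; exists (Ordinal lt_in); rewrite ?mem_enum // tnth_mktuple /= nth_index //.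
  rewrite letterX ?Du // -ltn_divLR // -Du.
  by move: u_k; rewrite mem_iota.
rewrite -mem_nonskips.
have [g vg lead_g] := top_vanishing_lead (pts_top f If) lead_f.
apply: (footprint uniq_pts _ _ _ vg lead_g).
- by rewrite map_inj_in_uniq ?filter_uniq ?words_uniq // => v w;
    rewrite !mem_filter => /andP[_ v_words] /andP[_ w_words]; apply: mon_inj.
- by rewrite size_pts.
- move=> m; rewrite mem_nonskips => /lead_of_bounded_nonskip[h Ih lead_h].
  exact: top_vanishing_lead (pts_top h Ih) lead_h.
Qed.

Lemma bounded_nonskip_standard : is_standard_monomial_basis inI bounded_nonskip.
Proof.
move=> m; split => [nonskip_m f l If _ lead_f|std_m].
  apply/negP => le_lm; move/negP: (lead_not_bounded_nonskip If lead_f); apply.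
  exact: bounded_nonskip_le le_lm nonskip_m.
apply/negPn/negP => /lead_of_bounded_nonskip[f If lead_f].
have f_neq0 : f != 0 by rewrite -msupp_eq0; case: lead_f; case: (msupp f).
by have := std_m f m If f_neq0 lead_f; rewrite lepm_refl.
Qed.

End StandardMonomials.

Theorem theorem4p10 (R : realType) (r n k : nat)
    (hr : (2 <= r)%N) (hk : (0 < k)%N) (hkn : (k <= n)%N) :
  is_standard_monomial_basis (@idealI R[i] n k r) (@nonskip n k r) /\
  is_standard_monomial_basis (@idealJ R[i] n k r) (@strongly_nonskip n k r).
Proof.
have r_gt0 : (0 < r)%N by apply: leq_trans hr.
split=> m.
  have -> : nonskip k r m = bounded_nonskip k r 1 m.
    rewrite /nonskip /bounded_nonskip addn1; congr (_ && _).
    by apply: eq_forallb => i; rewrite mnm1_mul_le -ltnNge.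
  have := @bounded_nonskip_standard R[i] n k r 1 r_gt0 hk hkn isT m.
  by rewrite addn1.
have -> : strongly_nonskip k r m = bounded_nonskip k r 0 m.
  rewrite /strongly_nonskip /nonskip /bounded_nonskip addn0 andbAC; congr (_ && _).
  rewrite -[RHS]andTb; apply/andP/forallP => [[_ /forallP lt_m] i|lt_m].
    by have := lt_m i; rewrite mnm1_mul_le -ltnNge.
  by split; apply/forallP => i; rewrite mnm1_mul_le -ltnNge // ltnW // ltnS lt_m.
have := @bounded_nonskip_standard R[i] n k r 0 r_gt0 hk hkn isT m.
by rewrite addn0.
Qed.
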